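(* Let $n,r$ be positive integers and let $A\in\mathbb{R}^{n\times r}_{\ge 0}$ have rank $r$ (so $A$ is a nonnegative symmetric rank factor of $M=AA^T$). Then $A$ is infinitesimally rigid if and only if $W_A^\vee\cong\mathbb{R}^{\binom r2}$, i.e. $W_A^\vee$ is the whole $\binom r2$-dimensional space.
   Context: Let $a_1^T,\dots,a_n^T$ be the rows of $A$. An infinitesimal motion of $A$ is a matrix $\dot A\in\mathbb{R}^{n\times r}$ with rows $\dot a_1^T,\dots,\dot a_n^T$ such that $a_i^T\dot a_j+\dot a_i^Ta_j=0$ for all $(i,j)\in[n]\times[n]$, and such that for some $\epsilon>0$, $a_i+t\dot a_i\ge 0$ entrywise for all $i$ and all $t\in[0,\epsilon)$. $A$ is infinitesimally rigid if it has no (nonzero) infinitesimal motions. The space of skew-symmetric $r\times r$ real matrices $D$ (the tangent space at $I$ of the orthogonal group $\mathrm{O}(r)$) is identified with $\mathbb{R}^{\binom r2}$ via the coordinates $d_{ij}$, $i<j$, above the diagonal. $W_A\subseteq\mathbb{R}^{\binom r2}$ is the cone of those skew-symmetric $D$ for which $AD$ is an infinitesimal motion; it is the polyhedral cone given by the inequalities $d_j^Ta_i\ge 0$ for all $(i,j)$ such that the $j$th entry of $a_i$ is zero, where $d_j$ is the $j$th column of $D$. $W_A^\vee$ is the dual cone of $W_A$ in (the dual of) $\mathbb{R}^{\binom r2}$. *)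

(* Defs.v *)
From HB Require Import structures.
From mathcomp Require Import all_boot all_order all_algebra.
From mathcomp Require Import classical_sets reals.

Set Implicit Arguments.
Unset Strict Implicit.
Unset Printing Implicit Defensive.

Import Order.TTheory GRing.Theory Num.Theory.
Local Open Scope classical_set_scope.
Local Open Scope ring_scope.

(* The rows of A are the vectors a_i^T, so A i k is the k-th entry of a_i. *)
Definition infinitesimal_motion (R : realType) (n r : nat)
    (A A' : 'M[R]_(n, r)) : Prop :=
  (forall i j : 'I_n,
     \sum_(k < r) A i k * A' j k + \sum_(k < r) A' i k * A j k = 0) /\
  (exists2 eps : R, 0 < eps &
     forall t : R, 0 <= t -> t < eps ->
     forall (i : 'I_n) (k : 'I_r), 0 <= A i k + t * A' i k).

Definition infinitesimally_rigid (R : realType) (n r : nat)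
    (A : 'M[R]_(n, r)) : Prop :=
  forall A' : 'M[R]_(n, r), infinitesimal_motion A A' -> A' = 0.

Definition skew_symmetric (R : realType) (r : nat) (D : 'M[R]_r) : Prop :=
  D^T = - D.

Definition upper_pair (r : nat) : finType :=
  {p : 'I_r * 'I_r | (p.1 < p.2)%N}.

(* R^(r choose 2), with coordinates indexed by the pairs i < j;               *)
(* dim_upper_space below checks the dimension.                                *)
Definition upper_space (R : realType) (r : nat) : vectType R :=
  {ffun upper_pair r -> R^o}.

(* Restricted to skew-symmetric matrices, this is the identification of the   *)
(* tangent space of O(r) at I with R^(r choose 2).                            *)
Definition upper_coord (R : realType) (r : nat) (D : 'M[R]_r) :
    upper_space R r :=
  [ffun p : upper_pair r => D (val p).1 (val p).2 : R^o].

Definition motion_cone (R : realType) (n r : nat) (A : 'M[R]_(n, r)) :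
    set (upper_space R r) :=
  @upper_coord R r @`
    [set D | skew_symmetric D /\ infinitesimal_motion A (A *m D)].

Definition dual_cone (R : realType) (V : vectType R) (C : set V) :
    set 'Hom(V, R^o) :=
  [set f : 'Hom(V, R^o) | forall v, C v -> 0 <= (f v : R)].

Lemma card_upper_pair (r : nat) : #|upper_pair r| = 'C(r, 2).
Proof.
rewrite card_sig -bin2_sum -sum1_card big_mkord.
rewrite (eq_bigl (fun p : 'I_r * 'I_r => true && (p.1 < p.2)%N)) //.
rewrite -(pair_big_dep xpredT (fun i j : 'I_r => (i < j)%N) (fun _ _ => 1%N)) /=.
rewrite (exchange_big_dep xpredT) //=; apply: eq_bigr => j _.
rewrite sum1_card -[RHS]card_ord.
rewrite -(card_image (f := widen_ord (ltnW (ltn_ord j)))); last first.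
  by move=> x y /(congr1 val) /= /val_inj.
apply: eq_card => i; rewrite unfold_in /=.
apply/idP/fintype.imageP => [lt_ij | [k _ ->]]; last exact: (ltn_ord k).
by exists (Ordinal lt_ij) => //; apply: val_inj.
Qed.

Lemma dim_upper_space (R : realType) (r : nat) :
  \dim {: upper_space R r} = 'C(r, 2).
Proof. by rewrite dimvf -card_upper_pair /dim /= muln1. Qed.

(* Main.v *)
Require Import Defs.
From mathcomp Require Import all_boot all_order all_algebra.
From mathcomp Require Import classical_sets reals.

(** The rank hypothesis gives [A] a left inverse [B], and then the first-order
    condition [A A'^T + A' A^T = 0] says exactly that [A' = A D] for a
    skew-symmetric [D]: the infinitesimal motions of [A] are the motions
    parametrized by its motion cone ([skew_factor]).  As [D] is determined both
    by [A D] and by its entries above the diagonal, [A] is rigid if and only if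
    its motion cone contains no nonzero vector.  A cone has this property if
    and only if every linear form is nonnegative on it, since the forms come in
    opposite pairs and separate the points of the space
    ([dual_cone_setTP]). *)

Set Implicit Arguments.
Unset Strict Implicit.
Unset Printing Implicit Defensive.

Import Order.TTheory GRing.Theory Num.Theory.
Local Open Scope classical_set_scope.
Local Open Scope ring_scope.

Lemma linear_forms_separate (R : realType) (V : vectType R) (v : V) :
  (forall f : 'Hom(V, R^o), f v = 0) -> v = 0.
Proof.
move=> fv0; rewrite (coord_vbasis (memvf v)) big1 // => i _.
have := fv0 (linfun (coord (vbasis {:V}) i : V -> R^o)).
by rewrite lfunE /= => ->; rewrite scale0r.
Qed.

(** If the dual is everything, then [f] and [- f] are both nonnegative on [C],
    so every linear form vanishes on [C]. *)
Lemma dual_cone_setTP (R : realType) (V : vectType R) (C : set V) :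
  dual_cone C = setT <-> (forall v, C v -> v = 0).
Proof.
split=> [dualT v Cv | C0].
  have dual_ge0 (f : 'Hom(V, R^o)) : 0 <= (f v : R).
    by have dual_f : dual_cone C f by [rewrite dualT]; apply: dual_f.
  apply: linear_forms_separate => f; apply: (@le_anti _ R).
  have := dual_ge0 (- f); rewrite opp_lfunE oppr_ge0 => ->.
  exact: dual_ge0.
by apply/seteqP; split=> // f _ v /C0 ->; rewrite linear0.
Qed.

Lemma upper_coord_inj0 (R : realType) (r : nat) (D : 'M[R]_r) :
  skew_symmetric D -> upper_coord D = 0 -> D = 0.
Proof.
move=> skewD coordD0.
have skewE i j : D j i = - D i j by have /matrixP/(_ i j) := skewD; rewrite !mxE.
have upper0 (i j : 'I_r) : (i < j)%N -> D i j = 0.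
  move=> lt_ij; have /ffunP/(_ (exist _ (i, j) lt_ij)) := coordD0.
  by rewrite !ffunE.
apply/matrixP => i j; rewrite mxE.
case: (ltngtP i j) => [/upper0 // | lt_ji | /val_inj ->].
  by rewrite skewE upper0 // oppr0.
by apply/eqP; rewrite -eqNr -skewE.
Qed.

Lemma infinitesimal_motion_gram (R : realType) (n r : nat)
    (A A' : 'M[R]_(n, r)) :
  infinitesimal_motion A A' -> A *m A'^T + A' *m A^T = 0.
Proof.
case=> gram0 _; apply/matrixP => i j; rewrite !mxE -[RHS](gram0 i j).
by congr (_ + _); apply: eq_bigr => k _; rewrite mxE.
Qed.

(** If [B] is a left inverse of [A], multiplying the hypothesis by [B^T] on the
    right gives [A' = A D] with [D = - A'^T B^T].  The hypothesis then reads
    [A (D^T + D) A^T = 0], where [A] and [A^T] can be cancelled. *)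
Lemma skew_factor (R : realType) (n r : nat) (A A' : 'M[R]_(n, r)) :
  row_full A -> A *m A'^T + A' *m A^T = 0 ->
  exists2 D : 'M[R]_r, skew_symmetric D & A' = A *m D.
Proof.
move=> /row_fullP fullA gram0.
have [B BA1] : exists B : 'M[R]_(r, n), B *m A = 1%:M := fullA.
have ATBT1 : A^T *m B^T = 1%:M by rewrite -trmx_mul BA1 trmx1.
have defA' : A' = A *m - (A'^T *m B^T).
  rewrite mulmxN mulmxA; apply/eqP; rewrite -addr_eq0 addrC.
  by rewrite -[X in _ + X]mulmx1 -ATBT1 mulmxA -mulmxDl gram0 mul0mx.
exists (- (A'^T *m B^T)) => //; move: defA'; set D := - _ => defA'.
apply/eqP; rewrite -addr_eq0; apply/eqP.
have <- : B *m (A *m (D^T *m A^T) + A *m D *m A^T) *m B^T = D^T + D.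
  by rewrite mulmxDr mulmxDl !mulmxA BA1 !mul1mx -!mulmxA ATBT1 !mulmx1.
by rewrite -trmx_mul -defA' gram0 mulmx0 mul0mx.
Qed.

Theorem proposition6p2 (R : realType) (n r : nat) (A : 'M[R]_(n, r))
    (hn : (0 < n)%N) (hr : (0 < r)%N)
    (hA0 : forall (i : 'I_n) (k : 'I_r), 0 <= A i k)
    (hArank : \rank A = r) :
  infinitesimally_rigid A <-> dual_cone (motion_cone A) = [set: 'Hom(upper_space R r, R^o)].
Proof.
have fullA : row_full A by rewrite /row_full hArank.
rewrite dual_cone_setTP; split=> [rigidA _ [D [_ motionAD] <-] | cone0 A' motionA'].
  have D0 : D = 0 by apply: (row_full_inj fullA); rewrite mulmx0; apply: rigidA.
  by apply/ffunP => p; rewrite !ffunE D0 mxE.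
have [D skewD defA'] := skew_factor fullA (infinitesimal_motion_gram motionA').
rewrite defA' (upper_coord_inj0 skewD) ?mulmx0 //.
by apply: cone0; exists D => //; split; rewrite -?defA'.
Qed.
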